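(* Let $(\mathbf{C},p,\mathbf{Q},I)$ be a generalized Brascamp-Lieb datum with $p_j>0$ for all $j$. Let $B=(B_j)_{1\le j\le m}$ with $B_j:H_j\to H_j$ positive definite such that $0<B_j\le Q_j$ for every $j\in I$ and $B_j\ge Q_j$ for every $j\in I^c$. Set $M=\sum_{j=1}^m p_jC_j^*B_jC_j$. Then the following are equivalent: (a) $B$ is a global extremizer, i.e. $\displaystyle\mathrm{BL}(\mathbf{C},p,\mathbf{Q},I)=\frac{\prod_{j=1}^m\det(B_j)^{p_j/2}}{\det(M)^{1/2}}$; (b) $B$ is a local extremizer; (c) $M$ is invertible, $B_j^{-1}\ge C_jM^{-1}C_j^*$ for all $j\in I$, $B_j^{-1}\le C_jM^{-1}C_j^*$ for all $j\in I^c$, and $(B_j^{-1}-C_jM^{-1}C_j^* )(Q_j-B_j)=0$ for all $1\le j\le m$; (d) $(\mathbf{C},p,\mathbf{Q},I)$ is equivalent to a generalized geometric Brascamp-Lieb datum $(\mathbf{C}',p',\mathbf{Q}',I)$ with intertwining operators $D=M^{-1/2}$ and $D_j=B_j^{-1/2}$.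
   Context: A generalized Brascamp-Lieb datum $(\mathbf{C},p,\mathbf{Q},I)$ consists of: Euclidean spaces $H,H_1,\dots,H_m$; surjective linear maps $C_i:H\to H_i$ with $\bigcap_i\ker(C_i)=\{0\}$; exponents $p_i>0$; positive definite self-adjoint maps $Q_i:H_i\to H_i$; and $I\subset\{1,\dots,m\}$, $I^c$ its complement. Its constant is $$\mathrm{BL}(\mathbf{C},p,\mathbf{Q},I)=\sup_{\substack{0<A_i\le Q_i\ \forall i\in I\\ A_j\ge Q_j\ \forall j\in I^c}}\left\{\frac{\prod_{i=1}^m(\det A_i)^{p_i}}{\det\left(\sum_{i=1}^m p_iC_i^*A_iC_i\right)}\right\}^{1/2}.$$ $A\le B$ means $B-A$ is positive semi-definite. A local extremizer is a tuple satisfying the constraints which is a local maximum, within the constraint set, of the function of $(A_1,\dots,A_m)$ whose supremum is taken. Two data $(\mathbf{C},p,\mathbf{Q},I)$ and $(\mathbf{C}',p',\mathbf{Q}',I')$ are equivalent if $I=I'$, $p=p'$ and there exist invertible linear maps $D:H'\to H$, $D_j:H_j'\to H_j$ (intertwining transformations) with $C_j'=D_j^{-1}C_jD$ and $Q_j'=D_j^*Q_jD_j$ for all $j$. A datum $(\mathbf{C},p,\mathbf{Q},I)$ is generalized geometric if $\sum_{j=1}^m p_jC_j^*C_j=\mathrm{id}_H$; $C_jC_j^*\le\mathrm{id}_{H_j}$ and $Q_j\ge\mathrm{id}_{H_j}$ for $j\in I$; $C_jC_j^*\ge\mathrm{id}_{H_j}$ and $Q_j\le\mathrm{id}_{H_j}$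 for $j\in I^c$; and $(\mathrm{id}_{H_j}-C_jC_j^* )(Q_j-\mathrm{id}_{H_j})=0$ for all $j$. *)

(* Defs.v *)
From mathcomp Require Import all_boot all_order all_algebra.
From mathcomp Require Import all_classical all_reals all_analysis.

Set Implicit Arguments.
Unset Strict Implicit.
Unset Printing Implicit Defensive.

Import Order.TTheory GRing.Theory Num.Theory.
Import numFieldNormedType.Exports.

Local Open Scope classical_set_scope.
Local Open Scope ring_scope.

(* Euclidean spaces are coordinatized by orthonormal bases: a linear map
   R^n -> R^k is a k x n matrix acting on column vectors, and its adjoint is
   the transpose. *)

Definition psdmx (R : realType) (n : nat) (A : 'M[R]_n) : Prop :=
  A^T = A /\ forall v : 'cV[R]_n, 0 <= (v^T *m A *m v) 0 0.

Definition posdefmx (R : realType) (n : nat) (A : 'M[R]_n) : Prop :=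
  A^T = A /\ forall v : 'cV[R]_n, v != 0 -> 0 < (v^T *m A *m v) 0 0.

Definition lemx (R : realType) (n : nat) (A B : 'M[R]_n) : Prop :=
  psdmx (B - A).

(* For positive semidefinite A the set below is a singleton, so the default
   value 0 of xget is only used when A is not positive semidefinite. *)
Definition sqrtmx (R : realType) (n : nat) (A : 'M[R]_n) : 'M[R]_n :=
  xget 0 [set S : 'M[R]_n | psdmx S /\ S *m S = A].

Record bl_datum (R : realType) (m n : nat) (d : 'I_m -> nat) := BLDatum {
  bl_map : forall j : 'I_m, 'M[R]_(d j, n);
  bl_exp : 'I_m -> R;
  bl_bound : forall j : 'I_m, 'M[R]_(d j);
  bl_upper : {set 'I_m};
  bl_map_surj : forall (j : 'I_m) (w : 'cV[R]_(d j)),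
    exists v : 'cV[R]_n, bl_map j *m v = w;
  bl_map_ker : forall v : 'cV[R]_n, (forall j, bl_map j *m v = 0) -> v = 0;
  bl_exp_gt0 : forall j : 'I_m, 0 < bl_exp j;
  bl_bound_posdef : forall j : 'I_m, posdefmx (bl_bound j)
}.

Section BrascampLieb.
Context {R : realType} {m n : nat} {d : 'I_m -> nat}.
Implicit Types (X : bl_datum R n d) (A B : forall j : 'I_m, 'M[R]_(d j)).

Definition bl_form X A : 'M[R]_n :=
  \sum_(j < m) bl_exp X j *: ((bl_map X j)^T *m A j *m bl_map X j).

Definition bl_admissible X A : Prop :=
  (forall j, j \in bl_upper X -> posdefmx (A j) /\ lemx (A j) (bl_bound X j)) /\
  (forall j, j \notin bl_upper X -> lemx (bl_bound X j) (A j)).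

Definition bl_objective X A : R :=
  Num.sqrt ((\prod_(j < m) (\det (A j)) `^ bl_exp X j) / \det (bl_form X A)).

(* The supremum may be +oo. *)
Definition bl_const X : \bar R :=
  ereal_sup [set (bl_objective X A)%:E | A in [set A | bl_admissible X A]].

(* The balls ball (B j) e of the m matrix spaces give, m being finite, a basis
   of neighborhoods of the tuple B in their product. *)
Definition bl_local_extremizer X B : Prop :=
  bl_admissible X B /\
  exists2 e : R, 0 < e &
    forall A, bl_admissible X A -> (forall j, ball (B j) e (A j)) ->
      bl_objective X A <= bl_objective X B.

Definition bl_geometric X : Prop :=
  [/\ \sum_(j < m) bl_exp X j *: ((bl_map X j)^T *m bl_map X j) = 1%:M,
      forall j, j \in bl_upper X ->
        lemx (bl_map X j *m (bl_map X j)^T) 1%:M /\ lemx 1%:M (bl_bound X j),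
      forall j, j \notin bl_upper X ->
        lemx 1%:M (bl_map X j *m (bl_map X j)^T) /\ lemx (bl_bound X j) 1%:M &
      forall j,
        (1%:M - bl_map X j *m (bl_map X j)^T) *m (bl_bound X j - 1%:M) = 0].

(* X and X' are equivalent, with intertwining transformations D and Dj.
   Invertible intertwining maps preserve dimensions, so both data live on the
   same coordinate spaces. *)
Definition bl_intertwined (D : 'M[R]_n) (Dj : forall j : 'I_m, 'M[R]_(d j))
    X X' : Prop :=
  [/\ bl_upper X = bl_upper X', bl_exp X = bl_exp X',
      D \in unitmx, forall j, Dj j \in unitmx &
      forall j, bl_map X' j = invmx (Dj j) *m bl_map X j *m D /\
                bl_bound X' j = (Dj j)^T *m bl_bound X j *m Dj j].

End BrascampLieb.

(* Main.v *)
Require Import Defs.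
From mathcomp Require Import all_boot all_order all_algebra.
From mathcomp Require Import all_classical all_reals all_analysis.
From mathcomp Require Import complex ring lra.
Import Order.TTheory GRing.Theory Num.Theory.
Import numFieldNormedType.Exports.
Local Open Scope classical_set_scope.
Local Open Scope ring_scope.

Set Implicit Arguments.
Unset Strict Implicit.
Unset Printing Implicit Defensive.

(** Write N_j = B_j^-1 - C_j M^-1 C_j^T; up to the factor p_j it is the gradient
    of the logarithm of the squared objective with respect to A_j, at B.

    A global extremizer is a local one.  At a local extremizer, one-sided
    perturbations along rank-one directions u u^T, for which both determinants
    in the objective are explicit, show that N_j has the sign prescribed by the
    constraint, and that N_j vanishes on the directions E_j w, where
    E_j = Q_j - B_j is the slack (bl_local_extremizer_critical).  These are the
    optimality conditions of (c).

    The conditions of (c) are turned into those defining a geometric datum by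
    the change of variables with D = M^(-1/2) and D_j = B_j^(-1/2), which sends
    B to the tuple of identities (bl_critical_geometric).

    Finally, the identities are global extremizers for a geometric datum: the
    inequality prod_j det(A_j)^p_j <= det (sum_j p_j C_j^T A_j C_j) holds for
    all admissible A (bl_geometric_det_le).  The natural variables are the
    matrix logarithms L_j of the A_j, in which the logarithm of the left-hand
    side is linear and that of the right-hand side lies above its tangent at
    L = 0: Jensen's inequality in an orthonormal eigenbasis of the right-hand matrix
    gives ln det (sum_j p_j C_j^T A_j C_j) >= sum_j p_j tr (C_j C_j^T L_j),
    whereas the logarithm of the left-hand side is sum_j p_j tr L_j.  The
    difference is controlled by tr ((1 - C_j C_j^T) L_j), whose sign follows
    from 1 - A^-1 <= L <= A - 1, from the constraint on A_j, and from
    complementary slackness.  Changing variables back gives (a)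
    (bl_intertwined_extremal).

    The matrix square roots and logarithms, and the eigenbases, come from the
    spectral theorem for real symmetric matrices (real_spectral). *)

(** * The spectral theorem for real symmetric matrices *)

Lemma row_sqnorm_gt0 (R : realType) (n : nat) (w : 'rV[R]_n) :
  w != 0 -> 0 < (w *m w^T) 0 0.
Proof.
have sq j : w 0 j * w^T j 0 = w 0 j ^+ 2 by rewrite mxE expr2.
move=> w0; rewrite mxE lt_def sumr_ge0 ?andbT => [|j _]; last first.
  by rewrite sq sqr_ge0.
apply: contra w0; rewrite psumr_eq0 => [/allP h|j _]; last first.
  by rewrite sq sqr_ge0.
apply/eqP/rowP => i; apply/eqP; rewrite mxE; have := h i.
by rewrite mem_index_enum /= sq sqrf_eq0 => ->.
Qed.

(** Over the complex numbers a symmetric real matrix is hermitian, hence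
    unitarily diagonalizable with real eigenvalues; an eigenvalue that is real
    is already one over the reals, because being an eigenvalue is the vanishing
    of a determinant. *)
Lemma symmetric_has_eigenvalue (R : realType) (n : nat) (A : 'M[R]_n.+1) :
  A^T = A -> exists a, eigenvalue A a.
Proof.
move=> symA; pose Ac := map_mx (real_complex R) A.
have hermA : Ac \is hermsymmx.
  apply: realsym_hermsym.
    by apply/is_hermitianmxP; rewrite expr0 scale1r map_mx_id // map_trmx symA.
  by apply/mxOverP => i j; rewrite mxE; apply/complex_realP; exists (A i j).
have /orthomx_spectralP := hermitian_normalmx hermA.
set P := spectralmx Ac; set l := spectral_diag Ac => defA.
have Pu : P \in unitmx := spectral_unit Ac.
have /mxOverP /(_ 0 0) /complex_realP [a la] := hermitian_spectral_diag_real hermA.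
exists a; rewrite -(eigenvalue_map (real_complex R)) -/Ac.
apply/eigenvalueP; exists (row 0 P).
  rewrite -row_mul {1}defA !mulmxA mulmxV // mul1mx row_mul row_diag_mx.
  by rewrite -/l in la; rewrite la -scalemxAl rowE.
apply/eqP => /(congr1 (mulmx^~ (invmx P))); rewrite mul0mx rowE mulmxK //.
by move/rowP/(_ 0); rewrite !mxE eqxx => /eqP; rewrite oner_eq0.
Qed.

(** The Householder reflection in the hyperplane orthogonal to v - e, where e is
    the first coordinate vector; it exchanges v and e. *)
Lemma unit_vector_reflection (R : realType) (n : nat) (v : 'rV[R]_n.+1) :
  v *m v^T = 1%:M ->
  exists H : 'M[R]_n.+1,
    [/\ H^T = H, H *m H = 1%:M & row 0 H = v].
Proof.
move=> v1; pose e : 'rV[R]_n.+1 := delta_mx 0 0; pose u := v - e.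
have e1 : e *m e^T = 1%:M.
  by rewrite trmx_delta mul_delta_mx [LHS]mx11_scalar mxE.
have [u0|u0] := eqVneq u 0.
  exists 1%:M; rewrite trmx1 mul1mx; split=> //.
  by rewrite row1; apply/esym/subr0_eq.
pose c := (v *m e^T) 0 0.
have ve : v *m e^T = c%:M by rewrite [LHS]mx11_scalar.
have ev : e *m v^T = c%:M by rewrite -[LHS]trmxK trmx_mul trmxK ve tr_scalar_mx.
have uu : u *m u^T = (2 * (1 - c))%:M.
  rewrite /u linearB /= mulmxBl !mulmxBr v1 e1 ve ev -!raddfB /=.
  by congr (_%:M); ring.
have c1 : 1 - c != 0.
  apply/eqP => c1; have := row_sqnorm_gt0 u0.
  by rewrite uu c1 mulr0 mxE ltxx.
pose H := 1%:M - (1 - c)^-1 *: (u^T *m u).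
have HT : H^T = H.
  by rewrite /H linearB /= linearZ /= trmx_mul trmxK trmx1.
have KK : (u^T *m u) *m (u^T *m u) = (2 * (1 - c)) *: (u^T *m u).
  by rewrite mulmxA -(mulmxA u^T) uu mul_mx_scalar -scalemxAl.
have HH : H *m H = 1%:M.
  rewrite /H mulmxBl mul1mx (mulmxBr (_ *: _)) mulmx1 -scalemxAl -scalemxAr KK !scalerA.
  have -> : (1 - c)^-1 / (1 - c) * (2 * (1 - c)) = (1 - c)^-1 + (1 - c)^-1.
    by field.
  by rewrite scalerDl opprB addrK subrK.
have vH : v *m H = e.
  rewrite /H mulmxBr mulmx1 -scalemxAr mulmxA.
  have -> : v *m u^T = (1 - c)%:M by rewrite /u linearB /= mulmxBr v1 ve raddfB.
  by rewrite mul_scalar_mx scalerA mulVf // scale1r /u opprB addrC subrK.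
by exists H; split=> //; rewrite rowE -/e -vH -mulmxA HH mulmx1.
Qed.

(** Conjugating by the reflection that carries a unit eigenvector to the first
    coordinate vector splits off a 1 x 1 block, and the induction applies to the
    complementary block. *)
Lemma real_spectral (R : realType) (n : nat) (A : 'M[R]_n) :
  A^T = A ->
  exists (O : 'M[R]_n) (l : 'rV[R]_n),
    O *m O^T = 1%:M /\ A = O^T *m diag_mx l *m O.
Proof.
elim: n A => [|n IHn] A symA.
  by exists 1%:M, 0; split; apply/matrixP => - [].
have [a /eigenvalueP [w wA w0]] := symmetric_has_eigenvalue symA.
pose s := (w *m w^T) 0 0.
have s_gt0 : 0 < s := row_sqnorm_gt0 w0.
pose v := (Num.sqrt s)^-1 *: w.
have vA : v *m A = a *: v by rewrite -scalemxAl wA !scalerA mulrC.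
have v1 : v *m v^T = 1%:M.
  rewrite /v linearZ /= -scalemxAl -scalemxAr scalerA -expr2 exprVn.
  rewrite sqr_sqrtr ?ltW // [w *m _]mx11_scalar -/s scale_scalar_mx.
  by rewrite mulVf ?gt_eqF.
have [H [HT HH Hv]] := unit_vector_reflection v1.
(* The dimension is written 1 + n for the block decomposition to apply. *)
pose K : 'M[R]_(1 + n) := H *m A *m H.
have KT : K^T = K by rewrite /K !trmx_mul symA HT mulmxA.
have K0 : row 0 K = a *: delta_mx 0 0.
  rewrite /K !row_mul Hv vA -scalemxAl; congr (_ *: _).
  by rewrite -Hv rowE -mulmxA HH mulmx1.
have defK : K = block_mx a%:M 0 0 (drsubmx K).
  have ur : ursubmx K = 0.
    apply/matrixP => i j; have /rowP/(_ (rshift 1 j)) := K0.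
    by rewrite ord1 !mxE lshift0 => ->; rewrite mulr0.
  have ul : ulsubmx K = a%:M.
    apply/matrixP => i j; have /rowP/(_ 0) := K0.
    by rewrite !ord1 !mxE !lshift0 eqxx mulr1.
  rewrite -[LHS]submxK ul ur; congr (block_mx _ _ _ _).
  by rewrite -[LHS]trmxK trmx_dlsub KT ur trmx0.
have [|O [l [OO defD]]] := IHn (drsubmx K); first by rewrite trmx_drsub KT.
pose P : 'M[R]_(1 + n) := block_mx 1%:M 0 0 O.
have PP : P *m P^T = 1%:M.
  rewrite /P tr_block_mx mulmx_block !trmx0 !mul0mx !mulmx0 trmx1 mulmx1 OO.
  by rewrite !addr0 !add0r -scalar_mx_block.
have PK : P^T *m diag_mx (row_mx a%:M l) *m P = K.
  rewrite defK diag_mx_row /P tr_block_mx !mulmx_block.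
  rewrite !trmx0 !mul0mx !mulmx0 trmx1 !mulmx1 !mul1mx !addr0 !add0r mul0mx.
  rewrite -defD; congr (block_mx _ _ _ _).
  by apply/matrixP => i j; rewrite !ord1 !mxE eqxx.
exists (P *m H), (row_mx a%:M l); split.
  by rewrite trmx_mul -mulmxA (mulmxA H) HT HH mul1mx.
have -> : A = H *m K *m H by rewrite /K !mulmxA HH mul1mx -mulmxA HH mulmx1.
by rewrite trmx_mul HT -PK !mulmxA.
Qed.

(** * Positive semidefinite and positive definite matrices *)

Section PositiveMatrices.
Context {R : realType}.

Lemma posdefmx_psd n (A : 'M[R]_n) : posdefmx A -> psdmx A.
Proof.
move=> [symA posA]; split=> // v; have [->|v0] := eqVneq v 0.
  by rewrite mulmx0 mxE.
exact/ltW/posA.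
Qed.

Lemma psdmxD n (A B : 'M[R]_n) : psdmx A -> psdmx B -> psdmx (A + B).
Proof.
move=> [symA posA] [symB posB]; split=> [|v]; first by rewrite linearD /= symA symB.
by rewrite mulmxDr mulmxDl mxE addr_ge0.
Qed.

Lemma psdmxZ n (a : R) (A : 'M[R]_n) : 0 <= a -> psdmx A -> psdmx (a *: A).
Proof.
move=> a0 [symA posA]; split=> [|v]; first by rewrite linearZ /= symA.
by rewrite -scalemxAr -scalemxAl mxE mulr_ge0.
Qed.

Lemma psdmx_sum n m (F : 'I_m -> 'M[R]_n) :
  (forall j, psdmx (F j)) -> psdmx (\sum_(j < m) F j).
Proof.
move=> psdF; elim/big_ind: _ => [|A B|j _] //; last exact: psdmxD.
by split=> [|v]; [rewrite trmx0 | rewrite mulmx0 mul0mx mxE].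
Qed.

Lemma psdmx_congr n k (P : 'M[R]_(n, k)) (A : 'M[R]_n) :
  psdmx A -> psdmx (P^T *m A *m P).
Proof.
move=> [symA posA]; split=> [|v]; first by rewrite !trmx_mul trmxK symA mulmxA.
by have := posA (P *m v); rewrite trmx_mul !mulmxA.
Qed.

Lemma posdefmx_congr n (P A : 'M[R]_n) :
  P \in unitmx -> posdefmx A -> posdefmx (P^T *m A *m P).
Proof.
move=> Pu [symA posA]; split=> [|v v0]; first by rewrite !trmx_mul trmxK symA mulmxA.
have := posA (P *m v); rewrite trmx_mul !mulmxA; apply.
by apply: contraNneq v0 => Pv0; rewrite -(mulKmx Pu v) Pv0 mulmx0.
Qed.

Lemma posdefmx_le n (A B : 'M[R]_n) : posdefmx A -> lemx A B -> posdefmx B.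
Proof.
move=> [symA posA] [symBA posBA]; rewrite -[B](subrK A); split=> [|v v0].
  by rewrite linearD /= symBA symA.
by rewrite mulmxDr mulmxDl mxE; apply: ltr_wpDl; [exact: posBA | exact: posA].
Qed.

Lemma lemx_congr n k (P : 'M[R]_(n, k)) (A B : 'M[R]_n) :
  lemx A B -> lemx (P^T *m A *m P) (P^T *m B *m P).
Proof. by move=> AB; rewrite /lemx -mulmxBl -mulmxBr; apply: psdmx_congr. Qed.

Lemma psdmx_dyad n (u : 'cV[R]_n) : psdmx (u *m u^T).
Proof.
split=> [|v]; first by rewrite trmx_mul trmxK.
rewrite mulmxA -mulmxA mxE big_ord1 -[v^T *m u]trmxK trmx_mul trmxK mxE.
by rewrite -expr2 sqr_ge0.
Qed.

Definition diagonal_conj n (U : 'M[R]_n) (l : 'rV[R]_n) : 'M[R]_n :=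
  U^T *m diag_mx l *m U.

Lemma psdmx_diagonal_conj n (U : 'M[R]_n) (l : 'rV[R]_n) :
  (forall i, 0 <= l 0 i) -> psdmx (diagonal_conj U l).
Proof.
move=> l0; apply: psdmx_congr; split=> [|v]; first by rewrite tr_diag_mx.
rewrite mxE sumr_ge0 // => i _; rewrite mul_mx_diag !mxE.
by rewrite mulrAC -expr2 mulr_ge0 ?sqr_ge0.
Qed.

Lemma diagonal_conjM n (U : 'M[R]_n) (k l : 'rV[R]_n) : U *m U^T = 1%:M ->
  diagonal_conj U k *m diagonal_conj U l =
  diagonal_conj U (\row_i (k 0 i * l 0 i)).
Proof.
move=> UU; rewrite /diagonal_conj !mulmxA -(mulmxA _ U) UU mulmx1.
by rewrite -(mulmxA U^T) mulmx_diag.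
Qed.

Lemma diagonal_conj_lin n (U : 'M[R]_n) (k l : 'rV[R]_n) (a : R) :
  diagonal_conj U (a *: k + l) = a *: diagonal_conj U k + diagonal_conj U l.
Proof.
by rewrite /diagonal_conj linearP /= mulmxDr mulmxDl -scalemxAr -scalemxAl.
Qed.

Lemma le_diagonal_conj n (U : 'M[R]_n) (k l : 'rV[R]_n) :
  (forall i, k 0 i <= l 0 i) -> lemx (diagonal_conj U k) (diagonal_conj U l).
Proof.
move=> kl; rewrite /lemx addrC -scaleN1r -diagonal_conj_lin.
by apply: psdmx_diagonal_conj => i; rewrite !mxE mulN1r addrC subr_ge0.
Qed.

Lemma diagonal_conj_const n (U : 'M[R]_n) (a : R) : U *m U^T = 1%:M ->
  diagonal_conj U (const_mx a) = a%:M.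
Proof.
move=> /mulmx1C UU; rewrite /diagonal_conj diag_const_mx mul_mx_scalar.
by rewrite -scalemxAl UU scalemx1.
Qed.

Lemma qform_row n (U Z : 'M[R]_n) i :
  (((row i U)^T)^T *m Z *m (row i U)^T) 0 0 = (U *m Z *m U^T) i i.
Proof.
rewrite trmxK -row_mul mxE [RHS]mxE.
by apply: eq_bigr => j _; rewrite !mxE.
Qed.

Lemma diagonal_conj_entry n (U : 'M[R]_n) (l : 'rV[R]_n) i : U *m U^T = 1%:M ->
  l 0 i = (((row i U)^T)^T *m diagonal_conj U l *m (row i U)^T) 0 0.
Proof.
move=> UU; rewrite qform_row.
have -> : U *m diagonal_conj U l *m U^T = diag_mx l.
  by rewrite /diagonal_conj !mulmxA UU mul1mx -mulmxA UU mulmx1.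
by rewrite mxE eqxx.
Qed.

Lemma det_diagonal_conj n (U : 'M[R]_n) (l : 'rV[R]_n) : U *m U^T = 1%:M ->
  \det (diagonal_conj U l) = \prod_i l 0 i.
Proof.
move=> UU; rewrite /diagonal_conj !det_mulmx mulrC mulrA -det_mulmx UU det1.
by rewrite mul1r det_diag.
Qed.

Lemma psdmx_spectral n (A : 'M[R]_n) : psdmx A ->
  exists (U : 'M[R]_n) (l : 'rV[R]_n),
    [/\ U *m U^T = 1%:M, A = diagonal_conj U l & forall i, 0 <= l 0 i].
Proof.
move=> [symA posA]; have [U [l [UU defA]]] := real_spectral symA.
by exists U, l; split=> // i; rewrite (diagonal_conj_entry l i UU) /diagonal_conj -defA.
Qed.

Lemma posdefmx_spectral n (A : 'M[R]_n) : posdefmx A ->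
  exists (U : 'M[R]_n) (l : 'rV[R]_n),
    [/\ U *m U^T = 1%:M, A = diagonal_conj U l & forall i, 0 < l 0 i].
Proof.
move=> [symA posA]; have [U [l [UU defA]]] := real_spectral symA.
exists U, l; split=> // i; rewrite (diagonal_conj_entry l i UU) /diagonal_conj -defA.
apply: posA; apply/eqP => /(congr1 (fun r => (r^T *m U^T) 0 i)).
rewrite trmxK -row_mul UU trmx0 mul0mx !mxE eqxx => /eqP.
by rewrite oner_eq0.
Qed.

Lemma posdefmx_det_gt0 n (A : 'M[R]_n) : posdefmx A -> 0 < \det A.
Proof.
move=> /posdefmx_spectral [U [l [UU -> l0]]].
by rewrite det_diagonal_conj // prodr_gt0.
Qed.

Lemma posdefmx_unit n (A : 'M[R]_n) : posdefmx A -> A \in unitmx.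
Proof. by move=> /posdefmx_det_gt0 A0; rewrite unitmxE unitfE gt_eqF. Qed.

Lemma posdefmx_inv n (A : 'M[R]_n) : posdefmx A -> posdefmx (invmx A).
Proof.
move=> posA; have Au := posdefmx_unit posA.
have symA : A^T = A by case: posA.
have -> : invmx A = (invmx A)^T *m A *m invmx A.
  by rewrite trmx_inv symA mulVmx // mul1mx.
by apply: posdefmx_congr; rewrite ?unitmx_inv.
Qed.

(** Completing the square: the difference of the inverses is
    D^T A D + B^-1 (B - A) B^-1, where D is that difference itself. *)
Lemma lemx_inv n (A B : 'M[R]_n) :
  posdefmx A -> lemx A B -> lemx (invmx B) (invmx A).
Proof.
move=> posA AB; have posB := posdefmx_le posA AB.
have [Au Bu] := (posdefmx_unit posA, posdefmx_unit posB).
have [iA iB] := (posdefmx_inv posA, posdefmx_inv posB).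
rewrite /lemx; set D := invmx A - invmx B.
have DT : D^T = D by rewrite /D linearB /= iA.1 iB.1.
have -> : D = D^T *m A *m D + (invmx B)^T *m (B - A) *m invmx B.
  have -> : D^T *m A *m D = D - invmx B + invmx B *m A *m invmx B.
    rewrite DT {1}/D mulmxBl mulVmx // mulmxBl mul1mx {2}/D mulmxBr.
    by rewrite -(mulmxA _ A (invmx A)) mulmxV // mulmx1 opprB addrA addrAC.
  rewrite iB.1 mulmxBr mulmxBl mulVmx // mul1mx.
  by rewrite [invmx B - _]addrC addrA addrK subrK.
apply: psdmxD; first exact/psdmx_congr/posdefmx_psd.
exact: psdmx_congr.
Qed.

Lemma sqrtmx_posdef n (A : 'M[R]_n) : posdefmx A ->
  psdmx (sqrtmx A) /\ sqrtmx A *m sqrtmx A = A.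
Proof.
move=> /posdefmx_spectral [U [l [UU defA l0]]].
rewrite /sqrtmx; case: xgetP => [S -> //|].
move=> /(_ (diagonal_conj U (map_mx Num.sqrt l))); case; split.
  by apply: psdmx_diagonal_conj => i; rewrite mxE sqrtr_ge0.
rewrite diagonal_conjM // defA; congr (diagonal_conj U _).
by apply/rowP => i; rewrite !mxE -expr2 sqr_sqrtr ?ltW.
Qed.

Lemma sqrtmx_inv_whiten k (A : 'M[R]_k) : posdefmx A ->
  let S := sqrtmx (invmx A) in
  [/\ S^T = S, S *m S = invmx A, S \in unitmx & S *m A *m S = 1%:M].
Proof.
move=> posA S; have [[symS _] SS] := sqrtmx_posdef (posdefmx_inv posA).
have SA : S *m (S *m A) = 1%:M by rewrite mulmxA SS mulVmx ?posdefmx_unit.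
split=> //; first by case/mulmx1_unit: SA.
exact: mulmx1C SA.
Qed.

Lemma mxtrace_psd_ge0 n (P E : 'M[R]_n) :
  psdmx P -> psdmx E -> 0 <= \tr (P *m E).
Proof.
move=> /psdmx_spectral [U [l [UU -> l0]]] psdE.
rewrite /diagonal_conj -!mulmxA mxtrace_mulC -!mulmxA mul_diag_mx.
rewrite sumr_ge0 // => i _; rewrite mxE mulr_ge0 //.
have [_ /(_ (row i U)^T)] := psdE.
by rewrite qform_row mulmxA.
Qed.

Lemma le_mxtrace n (P E F : 'M[R]_n) :
  psdmx P -> lemx E F -> \tr (P *m E) <= \tr (P *m F).
Proof.
by move=> psdP EF; rewrite -subr_ge0 -raddfB -mulmxBr mxtrace_psd_ge0.
Qed.

Lemma psdmx_isotropic n (N : 'M[R]_n) (v : 'cV[R]_n) :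
  psdmx N -> (v^T *m N *m v) 0 0 <= 0 -> N *m v = 0.
Proof.
move=> /psdmx_spectral [U [l [UU -> l0]]]; pose w := U *m v.
have sq i : 0 <= l 0 i * w i 0 ^+ 2 by rewrite mulr_ge0 ?sqr_ge0.
have -> : (v^T *m diagonal_conj U l *m v) 0 0 = \sum_i l 0 i * w i 0 ^+ 2.
  rewrite /diagonal_conj !mulmxA -(mulmxA _ U v) -trmx_mul -/w mul_mx_diag mxE.
  by apply: eq_bigr => i _; rewrite mxE [w^T _ _]mxE expr2 mulrA (mulrC _ (l 0 i)).
move=> s0; have /eqP : \sum_i l 0 i * w i 0 ^+ 2 = 0.
  by apply/le_anti; rewrite s0 sumr_ge0.
rewrite psumr_eq0 // => /allP s0'.
rewrite /diagonal_conj -!mulmxA -/w (_ : diag_mx l *m w = 0) ?mulmx0 //.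
apply/colP => i; rewrite mul_diag_mx mxE [RHS]mxE; apply/eqP.
by have := s0' i; rewrite mem_index_enum mulf_eq0 sqrf_eq0 -mulf_eq0; apply.
Qed.

Lemma psdmx_orthogonal k (N E : 'M[R]_k) : psdmx N ->
  (forall w : 'cV[R]_k, ((E *m w)^T *m N *m (E *m w)) 0 0 <= 0) ->
  N *m E = 0.
Proof.
move=> psdN NE; apply/trmx_inj/row_matrixP => i.
rewrite -tr_col colE -mulmxA (psdmx_isotropic psdN) //.
by rewrite !linear0.
Qed.

(** * Rank-one perturbations *)

(** The matrix determinant lemma, by factoring one bordered matrix into block
    triangular matrices in two ways. *)
Lemma det_add_dyad n (A : 'M[R]_n) (u : 'cV[R]_n) (t : R) : A \in unitmx ->
  \det (A + t *: (u *m u^T)) = \det A * (1 + t * (u^T *m invmx A *m u) 0 0).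
Proof.
move=> Au; pose x := invmx A *m u.
have -> : A + t *: (u *m u^T) = A *m (1%:M + t *: (x *m u^T)).
  by rewrite mulmxDr mulmx1 -scalemxAr mulmxA mulKVmx.
rewrite det_mulmx; congr (_ * _).
pose E := block_mx (1%:M : 'M[R]_1) (u^T) (- (t *: x)) 1%:M.
transitivity (\det E).
  have <- : block_mx 1%:M 0 (- (t *: x)) 1%:M *m
        block_mx 1%:M u^T 0 (1%:M + t *: (x *m u^T)) = E.
    rewrite mulmx_block !mul1mx !mul0mx !mulmx1 !addr0.
    by rewrite mulNmx -scalemxAl addrC addrK.
  by rewrite det_mulmx det_lblock det_ublock !det1 !mul1r.
have <- : block_mx 1%:M u^T 0 1%:M *m
      block_mx (1%:M + t *: (u^T *m x)) 0 (- (t *: x)) 1%:M = E.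
  rewrite mulmx_block !mul1mx !mul0mx !mulmx1 !add0r.
  by rewrite mulmxN -scalemxAr addrK.
rewrite det_mulmx det_lblock det_ublock !det1 !mul1r mulr1 det_mx11 /x.
by rewrite mulmxA !mxE eqxx.
Qed.

(** A form of the Cauchy-Schwarz inequality.  With a = w^T E w, congruence by
    W = 1 - c w w^T E turns E into E minus c (2 - c a) times the dyad of E w,
    and c (2 - c a) >= c as soon as c a <= 1. *)
Lemma psdmx_sub_dyad k (E : 'M[R]_k) (w : 'cV[R]_k) (c : R) :
  psdmx E -> 0 <= c -> c * (w^T *m E *m w) 0 0 <= 1 ->
  psdmx (E - c *: ((E *m w) *m (E *m w)^T)).
Proof.
move=> psdE c0 c1; have symE : E^T = E by case: psdE.
set a := (_ *m w) 0 0 in c1; set Y := _ *m (_)^T.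
have YE : Y = E *m (w *m w^T) *m E by rewrite /Y trmx_mul symE !mulmxA.
pose W := 1%:M - c *: (w *m w^T *m E).
have -> : E - c *: Y = W^T *m E *m W + (c * (1 - c * a)) *: Y.
  have WT : W^T *m E = E - c *: Y.
    rewrite /W linearB /= linearZ /= !trmx_mul trmxK trmx1 symE mulmxBl mul1mx.
    by rewrite -scalemxAl YE !mulmxA.
  have YW : Y *m (w *m w^T *m E) = a *: Y.
    transitivity ((E *m w) *m (w^T *m E *m w) *m (w^T *m E)).
      by rewrite YE !mulmxA.
    rewrite [w^T *m E *m w]mx11_scalar -/a mul_mx_scalar -scalemxAl.
    by rewrite YE !mulmxA.
  rewrite WT /W mulmxBr mulmx1 -scalemxAr mulmxBl -scalemxAl YW.
  rewrite [E *m (_ *m E)]mulmxA -YE scalerBr !scalerA mulrBr mulr1 scalerBl.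
  by rewrite mulrA subrK.
apply: psdmxD; first exact: psdmx_congr.
by apply/psdmxZ/psdmx_dyad; rewrite mulr_ge0 // subr_ge0.
Qed.

Lemma psdmx_sub_dyad_small k (E : 'M[R]_k) (w : 'cV[R]_k) (t : R) :
  psdmx E -> 0 < t -> t < (1 + (w^T *m E *m w) 0 0)^-1 ->
  psdmx (E - t *: ((E *m w) *m (E *m w)^T)).
Proof.
move=> psdE t0 ta; have a0 := psdE.2 w.
apply: psdmx_sub_dyad; rewrite ?ltW //.
move: ta; rewrite -[X in _ < X]mul1r ltr_pdivlMr ?ltr_wpDr // mulrDr mulr1; lra.
Qed.

Lemma posdefmx_sub_dyad_small k (E : 'M[R]_k) (u : 'cV[R]_k) (t : R) :
  posdefmx E -> 0 < t -> t < (1 + (u^T *m invmx E *m u) 0 0)^-1 / 2 ->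
  posdefmx (E - t *: (u *m u^T)).
Proof.
move=> posE t0 ta; have Eu := posdefmx_unit posE.
have symE : E^T = E by case: posE.
have psd2 : psdmx (E - (2 * t) *: (u *m u^T)).
  have := @psdmx_sub_dyad_small k E (invmx E *m u) (2 * t) (posdefmx_psd posE).
  rewrite mulKVmx // trmx_mul trmx_inv symE !mulmxA mulmxKV //; apply.
    by rewrite mulr_gt0.
  by rewrite mulrC -ltr_pdivlMr.
split=> [|v v0]; first by rewrite linearB /= linearZ /= trmx_mul trmxK symE.
have := posE.2 v v0; have := psd2.2 v.
rewrite !mulmxBr !mulmxBl -!scalemxAr -!scalemxAl -scalerA.
move: (v^T *m E *m v) (v^T *m (u *m u^T) *m v) => a b; rewrite !mxE; lra.
Qed.

(** * Logarithms *)

Lemma ln_prod (I : Type) (r : seq I) (f : I -> R) :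
  (forall i, 0 < f i) -> ln (\prod_(i <- r) f i) = \sum_(i <- r) ln (f i).
Proof.
move=> f0; elim: r => [|i r IHr]; first by rewrite !big_nil ln1.
by rewrite !big_cons lnM ?IHr // posrE // prodr_gt0.
Qed.

Lemma ln_tangent (x y : R) : 0 < x -> 0 < y -> ln x <= y^-1 * x + (ln y - 1).
Proof.
move=> x0 y0; have xy : 0 < y^-1 * x by rewrite mulr_gt0 ?invr_gt0.
have -> : ln x = ln (1 + (y^-1 * x - 1)) + ln y.
  rewrite addrCA subrr addr0 lnM ?posrE ?invr_gt0 // lnV ?posrE //.
  by rewrite addrC addrA subrr add0r.
have := @le_ln1Dx R (y^-1 * x - 1).
rewrite ltrBrDl subrr => /(_ xy); lra.
Qed.

(** Bernoulli's bound 1 + p x fails for p < 1; replacing x by x / (1 + x)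
    keeps the first-order part and gives a bound valid for all p >= 0. *)
Lemma powR_ge_tangent (x p : R) : 0 < 1 + x -> 0 <= p ->
  1 + p * (x / (1 + x)) <= (1 + x) `^ p.
Proof.
move=> x0 p0; rewrite /powR gt_eqF //.
apply: le_trans (expR_ge1Dx _); rewrite lerD2l ler_wpM2l //.
have := ln_tangent (_ : 0 < (1 + x)^-1) ltr01.
rewrite invr_gt0 => /(_ x0); rewrite lnV ?posrE // ln1 invr1.
have -> : x / (1 + x) = 1 - (1 + x)^-1 by field; rewrite gt_eqF.
lra.
Qed.

(** L is the matrix logarithm of A.  The tangent line of the logarithm at any
    point y bounds it from above, and the tangent at 1 applied to A^-1 bounds it
    from below; both bounds are checked on eigenvalues. *)
Lemma posdefmx_log n (A : 'M[R]_n) : posdefmx A ->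
  exists L : 'M[R]_n,
    [/\ \tr L = ln (\det A),
        forall y, 0 < y -> lemx L (y^-1 *: A + (ln y - 1)%:M) &
        lemx (1%:M - invmx A) L].
Proof.
move=> posA; have Au := posdefmx_unit posA.
have [U [l [UU defA l0]]] := posdefmx_spectral posA.
have lV i : 0 < (l 0 i)^-1 by rewrite invr_gt0.
have invA : invmx A = diagonal_conj U (map_mx GRing.inv l).
  rewrite -[RHS](mulKmx Au) {3}defA diagonal_conjM //.
  rewrite (_ : \row__ _ = const_mx 1) ?diagonal_conj_const ?mulmx1 //.
  by apply/rowP => i; rewrite !mxE divff // gt_eqF.
pose L := diagonal_conj U (map_mx (@ln R) l).
exists L; split=> [|y y0|].
- rewrite /L /diagonal_conj mxtrace_mulC mulmxA UU mul1mx mxtrace_diag.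
  rewrite defA det_diagonal_conj // ln_prod //.
  by apply: eq_bigr => i _; rewrite mxE.
- rewrite -(diagonal_conj_const _ UU) defA -diagonal_conj_lin.
  by apply: le_diagonal_conj => i; rewrite !mxE; apply: ln_tangent.
- rewrite addrC -scaleN1r invA -(diagonal_conj_const _ UU) -diagonal_conj_lin.
  apply: le_diagonal_conj => i; rewrite !mxE.
  have := ln_tangent (lV i) ltr01; rewrite lnV ?posrE // ln1 invr1; lra.
Qed.

End PositiveMatrices.

(** * The form and the objective of a datum *)

Section BrascampLiebData.
Context {R : realType} {m n : nat} {d : 'I_m -> nat}.
Implicit Types (X : bl_datum R n d) (A B : forall j : 'I_m, 'M[R]_(d j)).

Lemma bl_admissible_posdef X A : bl_admissible X A -> forall j, posdefmx (A j).
Proof.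
move=> [adI adIc] j; have [/adI[] //|/adIc] := boolP (j \in bl_upper X).
exact/posdefmx_le/bl_bound_posdef.
Qed.

Lemma bl_formD X A B :
  bl_form X (fun j => A j + B j) = bl_form X A + bl_form X B.
Proof.
rewrite /bl_form -big_split; apply: eq_bigr => j _ /=.
by rewrite mulmxDr mulmxDl scalerDr.
Qed.

Lemma bl_formZ X (a : R) A : bl_form X (fun j => a *: A j) = a *: bl_form X A.
Proof.
rewrite /bl_form scaler_sumr; apply: eq_bigr => j _.
by rewrite -scalemxAr -scalemxAl !scalerA mulrC.
Qed.

Lemma bl_form_le X A B :
  (forall j, lemx (A j) (B j)) -> lemx (bl_form X A) (bl_form X B).
Proof.
move=> AB; rewrite /lemx -scaleN1r -bl_formZ -bl_formD.
apply: psdmx_sum => j; apply: psdmxZ; first exact/ltW/bl_exp_gt0.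
by apply: psdmx_congr; rewrite scaleN1r; apply: AB.
Qed.

(** Every summand is psd, so a vector on which the sum vanishes is killed by all
    the maps of the datum, whose common kernel is trivial. *)
Lemma bl_form_posdef X A : (forall j, posdefmx (A j)) -> posdefmx (bl_form X A).
Proof.
move=> posA.
have psdF j : psdmx (bl_exp X j *: ((bl_map X j)^T *m A j *m bl_map X j)).
  apply: psdmxZ; first exact/ltW/bl_exp_gt0.
  exact/psdmx_congr/posdefmx_psd.
have [symF posF] := psdmx_sum psdF.
split=> // v v0; rewrite lt_def posF andbT; apply: contra v0 => /eqP.
rewrite /bl_form mulmx_sumr mulmx_suml summxE => /eqP.
rewrite psumr_eq0 => [/allP v0|j _]; last by case: (psdF j).
apply/eqP/(bl_map_ker (b := X)) => j; apply/eqP.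
have := v0 j; rewrite mem_index_enum => /(_ isT) /eqP.
rewrite -scalemxAr -scalemxAl mxE => /eqP.
rewrite mulf_eq0 gt_eqF ?bl_exp_gt0 //=; apply: contraTT => Cv0.
rewrite gt_eqF //; have [_ /(_ _ Cv0)] := posA j.
by rewrite trmx_mul !mulmxA.
Qed.

Lemma bl_objectiveE X A : bl_admissible X A ->
  bl_objective X A =
  (\prod_(j < m) (\det (A j)) `^ (bl_exp X j / 2)) / Num.sqrt (\det (bl_form X A)).
Proof.
move=> adA; rewrite /bl_objective.
rewrite sqrtrM ?prodr_ge0 // => [|j _]; last exact: powR_ge0.
have /ltW F0 := posdefmx_det_gt0 (bl_form_posdef X (bl_admissible_posdef adA)).
rewrite sqrtrV //; congr (_ / _).
elim/big_rec2: _ => [|j y x _ <-]; first by rewrite sqrtr1.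
by rewrite sqrtrM ?powR_ge0 // -powR12_sqrt ?powR_ge0 // -powRrM.
Qed.

(** Comparing the values of the objective with the square roots and the
    denominators cleared. *)
Lemma bl_objective_le X A B : bl_admissible X A -> bl_admissible X B ->
  (bl_objective X A <= bl_objective X B) =
  ((\prod_(j < m) (\det (A j)) `^ bl_exp X j) * \det (bl_form X B) <=
   (\prod_(j < m) (\det (B j)) `^ bl_exp X j) * \det (bl_form X A)).
Proof.
move=> adA adB.
have FA := posdefmx_det_gt0 (bl_form_posdef X (bl_admissible_posdef adA)).
have FB := posdefmx_det_gt0 (bl_form_posdef X (bl_admissible_posdef adB)).
have detB j : 0 < \det (B j) by apply/posdefmx_det_gt0/bl_admissible_posdef/adB.
have pB : 0 <= (\prod_(j < m) (\det (B j)) `^ bl_exp X j) / \det (bl_form X B).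
  by rewrite divr_ge0 ?ltW // prodr_gt0 // => j _; rewrite powR_gt0.
by rewrite /bl_objective ler_sqrt // ler_pdivrMr // mulrAC ler_pdivlMr.
Qed.

Lemma bl_extremal_const X B : bl_admissible X B ->
  bl_const X = (bl_objective X B)%:E <->
  forall A, bl_admissible X A -> bl_objective X A <= bl_objective X B.
Proof.
move=> adB; split=> [cX A adA|maxB].
  by rewrite -lee_fin -cX; apply: ereal_sup_ubound; exists A.
apply/le_anti/andP; split; last by apply: ereal_sup_ubound; exists B.
by apply: ge_ereal_sup => _ [A adA <-]; rewrite lee_fin; apply: maxB.
Qed.

(** * Geometric data *)

Lemma bl_geometric_form1 X :
  bl_geometric X -> bl_form X (fun=> 1%:M) = 1%:M.
Proof.
case=> <- _ _ _; rewrite /bl_form; apply: eq_bigr => j _.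
by rewrite mulmx1.
Qed.

(** Jensen's inequality for the logarithm.  If f is a unit eigenvector of the
    form F of A with eigenvalue mu, then mu averages the A j with total weight
    one, because the form of the identities is the identity.  The tangent
    bound for L j at y = mu therefore gives f^T (form of L) f <= ln mu, and the
    sum over an orthonormal eigenbasis of F compares the two traces. *)
Lemma bl_geometric_trace_log X A (L : forall j, 'M[R]_(d j)) :
  bl_geometric X -> (forall j, posdefmx (A j)) ->
  (forall j y, 0 < y -> lemx (L j) (y^-1 *: A j + (ln y - 1)%:M)) ->
  \tr (bl_form X L) <= ln (\det (bl_form X A)).
Proof.
move=> geoX posA leL.
have [U [mu [UU defF mu0]]] := posdefmx_spectral (bl_form_posdef X posA).
rewrite defF det_diagonal_conj // ln_prod //.
have -> : \tr (bl_form X L) = \tr (U *m bl_form X L *m U^T).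
  by rewrite mxtrace_mulC mulmxA (mulmx1C UU) mul1mx.
apply: ler_sum => i _.
have := bl_form_le X (fun j => leL j _ (mu0 i)).
rewrite bl_formD bl_formZ => -[_ /(_ (row i U)^T)].
have -> : bl_form X (fun j => (ln (mu 0 i) - 1)%:M) = (ln (mu 0 i) - 1)%:M.
  rewrite -scalemx1 -(bl_geometric_form1 geoX) -bl_formZ.
  by congr bl_form; apply: functional_extensionality_dep => j; rewrite scalemx1.
rewrite qform_row mulmxBr mulmxBl mulmxDr mulmxDl -scalemxAr -scalemxAl defF.
have -> : U *m diagonal_conj U mu *m U^T = diag_mx mu.
  by rewrite /diagonal_conj !mulmxA UU mul1mx -mulmxA UU mulmx1.
rewrite mul_mx_scalar -scalemxAl UU.
move: (U *m bl_form X L *m U^T) => Z; rewrite !mxE eqxx mulr1n mulr1 mulVf ?gt_eqF //.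
lra.
Qed.

(** After taking logarithms and applying Jensen's inequality, what remains for
    each j is that tr (P L) has the right sign, where P = 1 - C C^T and L is
    the logarithm of A.  For an upper bound A <= Q, P is psd and
    L <= A - 1 <= Q - 1; for a lower bound, - P is psd and
    L >= 1 - A^-1 >= 1 - Q^-1.  In both cases the outer term is annihilated
    by P, by the relation P (Q - 1) = 0. *)
Lemma bl_geometric_det_le X A : bl_geometric X -> bl_admissible X A ->
  \prod_(j < m) (\det (A j)) `^ bl_exp X j <= \det (bl_form X A).
Proof.
move=> geoX adA; have posA := bl_admissible_posdef adA.
have posF := bl_form_posdef X posA.
have powA j : 0 < \det (A j) `^ bl_exp X j by rewrite powR_gt0 ?posdefmx_det_gt0.
pose logA j := cid (posdefmx_log (posA j)).
pose L j := projT1 (logA j).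
have trL j : \tr (L j) = ln (\det (A j)) by case: (projT2 (logA j)).
have leL j y : 0 < y -> lemx (L j) (y^-1 *: A j + (ln y - 1)%:M).
  by case: (projT2 (logA j)) => _ + _; apply.
have geL j : lemx (1%:M - invmx (A j)) (L j) by case: (projT2 (logA j)).
rewrite -ler_ln ?posrE ?posdefmx_det_gt0 ?prodr_gt0 // ln_prod //.
apply: le_trans (bl_geometric_trace_log geoX posA leL).
rewrite /bl_form raddf_sum; apply: ler_sum => j _ /=.
rewrite ln_powR mxtraceZ ler_pM2l ?bl_exp_gt0 // -trL mxtrace_mulC mulmxA.
have [_ geoI geoIc geoQ] := geoX; have := geoQ j; rewrite mulmxBr mulmx1.
set P := 1%:M - _ => /subr0_eq PQ.
have -> : bl_map X j *m (bl_map X j)^T = 1%:M - P by rewrite /P opprB addrC subrK.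
have psdPI : j \in bl_upper X -> psdmx P by case/geoI.
have psdPIc : j \notin bl_upper X -> psdmx (- P) by case/geoIc; rewrite /P opprB.
rewrite mulmxBl mul1mx raddfB /= lerBrDl gerDr.
clearbody P; have [jI|jI] := boolP (j \in bl_upper X).
  have [_ AQ] := adA.1 j jI.
  have leLA := leL j 1 ltr01; rewrite invr1 scale1r ln1 sub0r in leLA.
  apply: le_trans (le_mxtrace (psdPI jI) leLA) _.
  rewrite mulmxDr mxtraceD mul_mx_scalar scaleN1r raddfN /= subr_le0 -{2}PQ.
  exact: le_mxtrace (psdPI jI) AQ.
have AQ := adA.2 j jI; have psdNP := psdPIc jI.
have Qu := posdefmx_unit (bl_bound_posdef X j).
have := le_mxtrace psdNP (geL j); rewrite !mulNmx !raddfN /= lerN2 => /le_trans.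
apply; rewrite mulmxBr mulmx1 raddfB /= subr_le0 -{1}(mulmxK Qu P) PQ.
have := le_mxtrace psdNP (lemx_inv (bl_bound_posdef X j) AQ).
by rewrite !mulNmx !raddfN /= lerN2.
Qed.

(** * Changes of variables *)

Lemma bl_intertwined_form D (Dj : forall j : 'I_m, 'M[R]_(d j)) X X' A :
  bl_intertwined D Dj X X' ->
  bl_form X' (fun j => (Dj j)^T *m A j *m Dj j) = D^T *m bl_form X A *m D.
Proof.
case=> _ eqp _ Dju eqX; rewrite /bl_form mulmx_sumr mulmx_suml.
apply: eq_bigr => j _; rewrite -eqp -scalemxAr -scalemxAl; congr (_ *: _).
have [-> _] := eqX j.
rewrite !trmx_mul trmx_inv !mulmxA.
rewrite -(mulmxA _ (invmx _) (Dj j)^T) mulVmx ?unitmx_tr // mulmx1.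
by rewrite -(mulmxA _ (Dj j) (invmx _)) mulmxV // mulmx1.
Qed.

Lemma bl_intertwined_admissible D (Dj : forall j : 'I_m, 'M[R]_(d j)) X X' A :
  bl_intertwined D Dj X X' -> bl_admissible X A ->
  bl_admissible X' (fun j => (Dj j)^T *m A j *m Dj j).
Proof.
move=> [eqI _ _ Dju eqX] [adI adIc]; split=> j; rewrite -eqI => jI.
  have [posA AQ] := adI j jI; split; first exact: posdefmx_congr.
  by have [_ ->] := eqX j; apply: lemx_congr.
by have [_ ->] := eqX j; apply/lemx_congr/adIc.
Qed.

(** A change of variables multiplies the squared objective by a constant, and
    it sends B to the identities, where the squared objective of the geometric
    datum is 1, an upper bound for all its values. *)
Lemma bl_intertwined_extremal D (Dj : forall j : 'I_m, 'M[R]_(d j)) X X' A B :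
  bl_geometric X' -> bl_intertwined D Dj X X' ->
  (forall j, (Dj j)^T *m B j *m Dj j = 1%:M) -> 
  bl_admissible X A -> bl_admissible X B ->
  bl_objective X A <= bl_objective X B.
Proof.
move=> geoX' XX' B1 adA adB; rewrite bl_objective_le //.
have posA := bl_admissible_posdef adA; have posB := bl_admissible_posdef adB.
have detDj j : \det (Dj j) ^+ 2 * \det (B j) = 1.
  by have := congr1 determinant (B1 j); rewrite !det_mulmx det_tr det1 => <-; ring.
have formB : D^T *m bl_form X B *m D = 1%:M.
  rewrite -(bl_intertwined_form _ XX') -(bl_geometric_form1 geoX').
  by congr bl_form; apply: functional_extensionality_dep.
have detD : \det D ^+ 2 * \det (bl_form X B) = 1.
  by have := congr1 determinant formB; rewrite !det_mulmx det_tr det1 => <-; ring.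
have := bl_geometric_det_le geoX' (bl_intertwined_admissible XX' adA).
rewrite (bl_intertwined_form _ XX') !det_mulmx det_tr.
have [_ eqp _ _ _] := XX'; rewrite -eqp.
have prodB : 0 < \prod_(j < m) (\det (B j)) `^ bl_exp X j.
  by rewrite prodr_gt0 // => j _; rewrite powR_gt0 // posdefmx_det_gt0.
have FB : 0 < \det (bl_form X B) by apply/posdefmx_det_gt0/bl_form_posdef.
have -> : \det D * \det (bl_form X A) * \det D =
    \det (bl_form X A) / \det (bl_form X B).
  by rewrite -[RHS]mulr1 -detD; field; rewrite gt_eqF.
rewrite ler_pdivlMr // => le1.
rewrite -(ler_pM2l prodB) in le1; apply: le_trans le1; rewrite mulrA.
rewrite ler_pM2r // -big_split /=; apply: ler_prod => j _.
rewrite powR_ge0 /= -powRM; first last.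
- by apply/ltW/posdefmx_det_gt0/posdefmx_congr; case: XX'.
- exact/ltW/posdefmx_det_gt0.
rewrite !det_mulmx det_tr.
rewrite (_ : _ * (_ * _) = \det (A j) * (\det (Dj j) ^+ 2 * \det (B j))).
  by rewrite detDj mulr1.
by ring.
Qed.

End BrascampLiebData.

Section Normalization.
Context {R : realType} {m n : nat} {d : 'I_m -> nat}.
Context (X : bl_datum R n d) (D : 'M[R]_n) (Dj : forall j : 'I_m, 'M[R]_(d j)).
Context (Du : D \in unitmx) (Dju : forall j, Dj j \in unitmx).

Let C' j := invmx (Dj j) *m bl_map X j *m D.

Lemma bl_change_map_surj j (w : 'cV[R]_(d j)) : exists v : 'cV[R]_n, C' j *m v = w.
Proof.
have [v Cv] := bl_map_surj X (Dj j *m w); exists (invmx D *m v).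
by rewrite /C' -!mulmxA mulKVmx // Cv mulKmx.
Qed.

Lemma bl_change_map_ker (v : 'cV[R]_n) : (forall j, C' j *m v = 0) -> v = 0.
Proof.
move=> Cv; rewrite -(mulKmx Du v) (bl_map_ker (b := X) (v := D *m v)) ?mulmx0 //.
move=> j; rewrite -[LHS](mulKVmx (Dju j)).
by have := Cv j; rewrite /C' -!mulmxA => ->; rewrite mulmx0.
Qed.

Lemma bl_change_bound_posdef j :
  posdefmx ((Dj j)^T *m bl_bound X j *m Dj j).
Proof. exact: posdefmx_congr (bl_bound_posdef X j). Qed.

Definition bl_change : bl_datum R n d :=
  BLDatum (bl_upper X) bl_change_map_surj bl_change_map_ker (bl_exp_gt0 X)
    bl_change_bound_posdef.

Lemma bl_change_intertwined : bl_intertwined D Dj X bl_change.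
Proof. by []. Qed.

End Normalization.

(** With D = M^(-1/2) and Dj = B j^(-1/2), the new datum satisfies
    1 - C' C'^T = Dj^-1 N Dj^-1 and Q' - 1 = Dj (Q - B) Dj, so the geometric
    conditions are the critical-point conditions for X, congruence by
    congruence. *)
Lemma bl_critical_geometric (R : realType) (m n : nat) (d : 'I_m -> nat)
    (X : bl_datum R n d) (B : forall j : 'I_m, 'M[R]_(d j)) :
  bl_admissible X B ->
  let N j := invmx (B j) -
    bl_map X j *m invmx (bl_form X B) *m (bl_map X j)^T in
  (forall j, j \in bl_upper X -> psdmx (N j)) ->
  (forall j, j \notin bl_upper X -> psdmx (- N j)) ->
  (forall j, N j *m (bl_bound X j - B j) = 0) ->
  exists2 X' : bl_datum R n d, bl_geometric X' &
    bl_intertwined (sqrtmx (invmx (bl_form X B)))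
      (fun j => sqrtmx (invmx (B j))) X X'.
Proof.
move=> adB N NI NIc NQ; have posB := bl_admissible_posdef adB.
have [symS SS Su SMS] := sqrtmx_inv_whiten (bl_form_posdef X posB).
set S := sqrtmx _ in symS SS Su SMS *.
pose T j := sqrtmx (invmx (B j)).
have symT j : (T j)^T = T j by case: (sqrtmx_inv_whiten (posB j)).
have TT j : T j *m T j = invmx (B j) by case: (sqrtmx_inv_whiten (posB j)).
have Tu j : T j \in unitmx by case: (sqrtmx_inv_whiten (posB j)).
have TBT j : T j *m B j *m T j = 1%:M by case: (sqrtmx_inv_whiten (posB j)).
pose X' := bl_change X Su Tu.
have XX' : bl_intertwined S T X X' := bl_change_intertwined X Su Tu.
exists X' => //.
have defN j : 1%:M - bl_map X' j *m (bl_map X' j)^T =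
    (invmx (T j))^T *m N j *m invmx (T j).
  rewrite /N mulmxBr mulmxBl -TT trmx_inv symT !mulmxA mulVmx // mul1mx mulmxV //.
  by rewrite !trmx_mul trmx_inv symT symS -SS !mulmxA.
have defQ j : bl_bound X' j - 1%:M = (T j)^T *m (bl_bound X j - B j) *m T j.
  by rewrite mulmxBr mulmxBl symT TBT /= symT.
split=> [|j jI|j jI|j].
- rewrite -[RHS]SMS -[X in X *m _ *m _]symS -(bl_intertwined_form B XX').
  rewrite /bl_form; apply: eq_bigr => j _.
  by rewrite symT TBT mulmx1.
- split; rewrite /lemx ?defN ?defQ; apply: psdmx_congr; first exact: NI.
  by case: (adB.1 j jI).
- split; rewrite /lemx -opprB ?defN ?defQ -mulNmx -mulmxN; apply: psdmx_congr.
    exact: NIc.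
  by rewrite opprB; apply: adB.2.
- rewrite defN defQ symT !mulmxA mulmxKV // -(mulmxA _ (N j)) NQ.
  by rewrite mulmx0 mul0mx.
Qed.

(** * Local extremizers *)

Section LocalExtremizers.
Context {R : realType} {m n : nat} {d : 'I_m -> nat}.
Implicit Types (X : bl_datum R n d) (A B : forall j : 'I_m, 'M[R]_(d j)).

Lemma ge0_of_affine (x y r : R) : 0 < r ->
  (forall t, 0 < t -> t < r -> 0 <= x + t * y) -> 0 <= x.
Proof.
move=> r0 h; rewrite leNgt; apply/negP => x0.
pose D := `|y| + 1; have D0 : 0 < D by rewrite ltr_wpDl.
pose t := Num.min (r / 2) (- x / (2 * D)).
have t0 : 0 < t.
  by rewrite lt_min !divr_gt0 ?mulr_gt0 // oppr_gt0.
have tr : t < r by rewrite gt_min ltr_pdivrMr // ltr_pMr // ltr1n.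
have tD : t * D <= - x / 2.
  rewrite -ler_pdivlMr // -mulrA -invfM ge_min lexx orbT //.
have ty : t * y <= t * D.
  by rewrite ler_pM2l // (le_trans (ler_norm y)) // lerDl.
have := h t t0 tr; lra.
Qed.

Lemma bl_admissible_dfwith X B j (E : 'M[R]_(d j)) : bl_admissible X B ->
  (j \in bl_upper X -> posdefmx E /\ lemx E (bl_bound X j)) ->
  (j \notin bl_upper X -> lemx (bl_bound X j) E) ->
  bl_admissible X (eqtype.dfwith B E).
Proof.
move=> [adI adIc] EI EIc; split=> k; case: eqtype.dfwithP => // k' jk.
  exact: adI.
exact: adIc.
Qed.

Lemma bl_form_dfwith X B j (E : 'M[R]_(d j)) :
  bl_form X (eqtype.dfwith B (B j + E)) =
  bl_form X B + bl_exp X j *: ((bl_map X j)^T *m E *m bl_map X j).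
Proof.
rewrite /bl_form (bigD1 j) //= [in RHS](bigD1 j) //= dfwith_in.
rewrite mulmxDr mulmxDl scalerDr addrAC; congr (_ + _ + _).
by apply: eq_bigr => k jk; rewrite dfwith_out // eq_sym.
Qed.

(** A rank-one change of B j multiplies the numerator of the objective by
    (1 + t a)^p and its denominator by 1 + t p b, so non-increase of the
    objective compares these two factors; bounding the power from below by its
    first-order part leaves an inequality that is affine in t up to the factor
    t. *)
Lemma bl_objective_dyad X B j (u : 'cV[R]_(d j)) (t : R) :
  let A := eqtype.dfwith B (B j + t *: (u *m u^T)) in
  let a := (u^T *m invmx (B j) *m u) 0 0 in
  let b := (u^T *m (bl_map X j *m invmx (bl_form X B) *m (bl_map X j)^T) *m u) 0 0 in
  bl_admissible X B -> bl_admissible X A ->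
  bl_objective X A <= bl_objective X B -> 0 <= t * (b - a + t * (a * b)).
Proof.
move=> A a b adB adA; rewrite bl_objective_le //.
have posB := bl_admissible_posdef adB.
have posA := bl_admissible_posdef adA.
have detB k : 0 < \det (B k) by apply: posdefmx_det_gt0.
have posM := bl_form_posdef X posB.
have Mu := posdefmx_unit posM; have M0 := posdefmx_det_gt0 posM.
have detA : \det (A j) = \det (B j) * (1 + t * a).
  by rewrite /A dfwith_in det_add_dyad ?posdefmx_unit.
have ta : 0 < 1 + t * a.
  by have := posdefmx_det_gt0 (posA j); rewrite detA pmulr_rgt0.
have detF : \det (bl_form X A) = \det (bl_form X B) * (1 + bl_exp X j * (t * b)).
  rewrite /A bl_form_dfwith -scalemxAr -scalemxAl scalerA.
  have -> : (bl_map X j)^T *m (u *m u^T) *m bl_map X j =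
    ((bl_map X j)^T *m u) *m ((bl_map X j)^T *m u)^T.
    by rewrite trmx_mul trmxK !mulmxA.
  rewrite det_add_dyad // trmx_mul trmxK mulrA /b.
  by rewrite !mulmxA.
have prodA : \prod_(k < m) (\det (A k)) `^ bl_exp X k =
    (\prod_(k < m) (\det (B k)) `^ bl_exp X k) * (1 + t * a) `^ bl_exp X j.
  rewrite (bigD1 j) //= [in RHS](bigD1 j) //= detA powRM ?ltW // mulrAC.
  congr (_ * _ * _); apply: eq_bigr => k jk.
  by rewrite /A dfwith_out // eq_sym.
have prodB : 0 < \prod_(k < m) (\det (B k)) `^ bl_exp X k.
  by rewrite prodr_gt0 // => k _; rewrite powR_gt0.
rewrite prodA detF -mulrA ler_pM2l // mulrC ler_pM2l // => le1.
have p0 := bl_exp_gt0 X j.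
have := le_trans (powR_ge_tangent ta (ltW p0)) le1.
rewrite lerD2l ler_pM2l // ler_pdivrMr // => h.
have -> : t * (b - a + t * (a * b)) = t * b * (1 + t * a) - t * a by ring.
by rewrite subr_ge0.
Qed.

(** The first-order condition in the direction s u u^T, with s a sign: the
    perturbation only has to be admissible on one side. *)
Lemma bl_local_extremizer_dyad X B j (u : 'cV[R]_(d j)) (s r : R) :
  let A t := eqtype.dfwith B (B j + (s * t) *: (u *m u^T)) in
  bl_local_extremizer X B -> s * s = 1 -> 0 < r ->
  (forall t, 0 < t -> t < r -> bl_admissible X (A t)) ->
  0 <= s * (u^T *m (bl_map X j *m invmx (bl_form X B) *m (bl_map X j)^T
                    - invmx (B j)) *m u) 0 0.
Proof.
move=> A [adB [e e0 maxB]] ss r0 adA.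
rewrite mulmxBr mulmxBl mxE [X in _ + X]mxE.
set b := (_ *m u) 0 0; set a := (_ *m u) 0 0.
(* The summand 1 keeps the bound N on the dyad positive when u = 0. *)
pose N := `|u *m u^T| + 1; have N0 : 0 < N by rewrite ltr_wpDl.
have s1 : `|s| = 1.
  by apply/eqP; rewrite -sqrp_eq1 // -normrX expr2 ss normr1.
apply: (@ge0_of_affine _ (a * b) (Num.min r (e / N))) => [|t t0].
  by rewrite lt_min r0 divr_gt0.
rewrite lt_min => /andP[tr te].
have ball_A k : ball (B k) e (A t k).
  rewrite /A; case: eqtype.dfwithP => [|k' _]; last exact: ballxx.
  rewrite mx_norm_ball /ball_ /= opprD addrA subrr sub0r normrN normrZ normrM s1.
  rewrite mul1r gtr0_norm //; apply: le_lt_trans (_ : t * N < e).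
    by rewrite ler_pM2l // lerDl.
  by rewrite -ltr_pdivlMr.
have := bl_objective_dyad adB (adA t t0 tr) (maxB _ (adA t t0 tr) ball_A).
rewrite -/a -/b.
have -> : s * t * (b - a + s * t * (a * b)) =
  t * (s * (b - a) + (s * s) * t * (a * b)) by ring.
by rewrite pmulr_rge0 // ss mul1r.
Qed.

(** Four families of one-sided rank-one perturbations of B j give everything.
    Moving B j away from the constraint in an arbitrary direction u (down below
    an upper bound, up above a lower bound) gives the sign of N j.  Moving it
    towards the constraint along u = E w, with E the gap between B j and its
    bound, stays admissible for small times by the Cauchy-Schwarz inequality,
    and gives the opposite sign of the quadratic form of N j at E w; the two
    signs force N j E w = 0. *)
Lemma bl_local_extremizer_critical X B : bl_local_extremizer X B ->
  let N j := invmx (B j) -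
    bl_map X j *m invmx (bl_form X B) *m (bl_map X j)^T in
  [/\ forall j, j \in bl_upper X -> psdmx (N j),
      forall j, j \notin bl_upper X -> psdmx (- N j) &
      forall j, N j *m (bl_bound X j - B j) = 0].
Proof.
move=> locB N; have [adB _] := locB; have posB := bl_admissible_posdef adB.
have posM := bl_form_posdef X posB.
have symB j : (B j)^T = B j by case: (posB j).
have symN j : (N j)^T = N j.
  rewrite /N linearB /= trmx_inv symB !trmx_mul trmxK trmx_inv.
  by case: posM => -> _; rewrite mulmxA.
have dyad j (u : 'cV[R]_(d j)) (s r : R) : s * s = 1 -> 0 < r ->
    (forall t, 0 < t -> t < r ->
      (j \in bl_upper X -> posdefmx (B j + (s * t) *: (u *m u^T)) /\
         lemx (B j + (s * t) *: (u *m u^T)) (bl_bound X j)) /\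
      (j \notin bl_upper X ->
         lemx (bl_bound X j) (B j + (s * t) *: (u *m u^T)))) ->
    0 <= - s * (u^T *m N j *m u) 0 0.
  move=> ss r0 adm.
  have := bl_local_extremizer_dyad locB ss r0 (u := u) (j := j).
  rewrite -[X in u^T *m X]opprB -/(N j) mulmxN mulNmx mxE mulrN -mulNr; apply.
  by move=> t t0 tr; have [hI hIc] := adm t t0 tr; apply: bl_admissible_dfwith.
have psdI j : j \in bl_upper X -> psdmx (N j).
  move=> jI; split=> // u; have [_ BQ] := adB.1 j jI.
  have iB0 := (posdefmx_psd (posdefmx_inv (posB j))).2 u.
  rewrite -[leRHS]mul1r -[X in X * _]opprK.
  (* Below this radius, B j - t u u^T stays positive definite. *)
  apply: (dyad _ _ _ ((1 + (u^T *m invmx (B j) *m u) 0 0)^-1 / 2)).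
  - by rewrite mulrNN mulr1.
  - by rewrite divr_gt0 // invr_gt0 ltr_wpDr.
  move=> t t0 tr; rewrite jI mulN1r scaleNr; split=> // _; split.
    exact: posdefmx_sub_dyad_small.
  rewrite /lemx opprB addrCA; apply: psdmxD => //.
  exact/psdmxZ/psdmx_dyad/ltW.
have psdIc j : j \notin bl_upper X -> psdmx (- N j).
  move=> jI; split=> [|u]; first by rewrite linearN /= symN.
  have BQ := adB.2 j jI.
  rewrite mulmxN mulNmx mxE -mulN1r.
  apply: (dyad _ _ _ 1) => //; first by rewrite mulr1.
  move=> t t0 tr; rewrite mul1r (negPf jI); split=> // _.
  rewrite /lemx addrAC; apply: psdmxD => //.
  exact/psdmxZ/psdmx_dyad/ltW.
split=> // j; have [jI|jI] := boolP (j \in bl_upper X).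
  have [_ psdE] := adB.1 j jI; rewrite /lemx in psdE.
  apply: psdmx_orthogonal; first exact: psdI.
  move=> w; set E := bl_bound X j - B j in psdE *.
  have E0 := psdE.2 w.
  (* Below this radius, E - t (E w) (E w)^T stays psd. *)
  rewrite -oppr_ge0 -mulN1r; apply: (dyad _ _ _ (1 + (w^T *m E *m w) 0 0)^-1).
  - by rewrite mulr1.
  - by rewrite invr_gt0 ltr_wpDr.
  move=> t t0 tr; rewrite jI mul1r; split=> // _.
  have tw := psdmx_sub_dyad_small psdE t0 tr; split.
    apply: (posdefmx_le (posB j)); rewrite /lemx addrAC subrr add0r.
    exact/psdmxZ/psdmx_dyad/ltW.
  by rewrite /lemx opprD addrA.
have psdE := adB.2 j jI; rewrite /lemx in psdE.
rewrite -[bl_bound X j - B j]opprB mulmxN -mulNmx.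
apply: psdmx_orthogonal; first exact: psdIc.
move=> w; set E := B j - bl_bound X j in psdE *.
have E0 := psdE.2 w.
rewrite mulmxN mulNmx mxE -oppr_ge0 opprK -[leRHS]mul1r -[X in X * _]opprK.
apply: (dyad _ _ _ (1 + (w^T *m E *m w) 0 0)^-1).
- by rewrite mulrNN mulr1.
- by rewrite invr_gt0 ltr_wpDr.
move=> t t0 tr; rewrite (negPf jI) mulN1r scaleNr; split=> // _.
have tw := psdmx_sub_dyad_small psdE t0 tr.
by rewrite /lemx addrAC.
Qed.

End LocalExtremizers.

(** * The equivalence *)

Unset Implicit Arguments.

Theorem proposition3p21 (R : realType) (m n : nat) (d : 'I_m -> nat)
    (X : bl_datum R n d) (B : forall j : 'I_m, 'M[R]_(d j))
    (hB : forall j, posdefmx (B j))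
    (hBI : forall j, j \in bl_upper X -> lemx (B j) (bl_bound X j))
    (hBIc : forall j, j \notin bl_upper X -> lemx (bl_bound X j) (B j)) :
  let M := \sum_(j < m) bl_exp X j *: ((bl_map X j)^T *m B j *m bl_map X j) in
  [<-> (* (a) *)
       bl_const X = ((\prod_(j < m) (\det (B j)) `^ (bl_exp X j / 2))
                       / Num.sqrt (\det M))%:E;
       (* (b) *)
       bl_local_extremizer X B;
       (* (c) *)
       [/\ M \in unitmx,
           forall j, j \in bl_upper X ->
             lemx (bl_map X j *m invmx M *m (bl_map X j)^T) (invmx (B j)),
           forall j, j \notin bl_upper X ->
             lemx (invmx (B j)) (bl_map X j *m invmx M *m (bl_map X j)^T) &
           forall j,
             (invmx (B j) - bl_map X j *m invmx M *m (bl_map X j)^T)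
               *m (bl_bound X j - B j) = 0];
       (* (d) *)
       exists2 X' : bl_datum R n d, bl_geometric X' &
         bl_intertwined (sqrtmx (invmx M)) (fun j => sqrtmx (invmx (B j))) X X'].
Proof.
move=> M.
have adB : bl_admissible X B by split=> // j jI; split=> //; exact: hBI.
have posM : posdefmx M := bl_form_posdef X hB.
rewrite -[X in X%:E](bl_objectiveE adB).
tfae.
- move/(bl_extremal_const adB) => maxB; split=> //.
  by exists 1 => // A adA _; apply: maxB.
- case/bl_local_extremizer_critical => NI NIc NQ; split=> //.
    exact: posdefmx_unit.
  by move=> j /NIc; rewrite opprB.
- case=> _ NI NIc NQ; apply: bl_critical_geometric => // j /NIc.
  by rewrite opprB.
- case=> X' geoX' XX'; apply/(bl_extremal_const adB) => A adA.
  apply: bl_intertwined_extremal geoX' XX' _ adA adB => j.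
  by case: (sqrtmx_inv_whiten (hB j)) => -> _ _.
Qed.
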